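(* Let $m$ be a positive integer and let $\alpha_0,\dots,\alpha_m$ be nonnegative real numbers satisfying $\alpha_0+\cdots+\alpha_m=1$. Then there are infinitely many sets $\mathcal{A}\subseteq\mathbb{N}_0$ such that for every integer $i$ with $0\le i\le m$ we have $$\mathcal{S}_i^{(2)}(\mathcal{A},N)=\alpha_i N+O(N^{3/4}).$$
   Context: $\mathbb{N}_0$ is the set of nonnegative integers and $\mathbb{N}$ the set of positive integers. For a nonempty set $\mathcal{A}\subseteq\mathbb{N}_0$ and an integer $n\ge 0$, $r_2(\mathcal{A},n)$ is the number of representations $n=a_1+a_2$ with $a_1\le a_2$ and $a_1,a_2\in\mathcal{A}$. For $u\in\mathbb{N}_0$ and $N\in\mathbb{N}$, $\mathcal{S}_u^{(2)}(\mathcal{A},N)=\#\{n\in\mathbb{N}: n\le N,\ r_2(\mathcal{A},n)=u\}$. The $O$-estimate is for $N\in\mathbb{N}$ with an implied constant independent of $N$ (it may depend on $m$, the $\alpha_i$ and $\mathcal{A}$). *)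

(* Defs.v *)
From mathcomp Require Import all_boot all_order all_algebra.
From mathcomp Require Import all_classical all_reals all_analysis.

Set Implicit Arguments.
Unset Strict Implicit.
Unset Printing Implicit Defensive.

(* Both summands of n are at most n, so the pairs may be taken in 'I_n.+1. *)
Definition r2 (A : set nat) (n : nat) : nat :=
  #|[set p : 'I_n.+1 * 'I_n.+1 |
      [&& `[< A p.1 >], `[< A p.2 >], (p.1 <= p.2)%N & (p.1 + p.2 == n)%N]]|.

Definition S2 (u : nat) (A : set nat) (N : nat) : nat :=
  #|[set n : 'I_N.+1 | (0 < n)%N && (r2 A n == u)]|.

(* Main.v *)
Require Import Defs.
From mathcomp Require Import all_boot all_order all_algebra.
From mathcomp Require Import all_classical all_reals all_analysis.
From mathcomp Require Import zify ring lra.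

Import Order.TTheory GRing.Theory Num.Theory.

(** Every [n] is uniquely [phi s + 4 * phi t], where [phi] reads base-4 digits
    in base 16; write [s = sig n], [t = tau n].  Thus [X = phi(N)] and
    [Y = 4 phi(N)] form a basis with exactly one representation of each [n],
    while [X + X] and [Y + Y] contain only [O(N^(3/4))] integers up to [N].  To
    give [n] the multiplicity [f (tau n)], replace [Y] by the elements
    [phi j + 4 * phi t] with [j < f t]: the representations of [n] then
    correspond to the [j < f (tau (n - phi j))].  If [f] is constant on long
    aligned blocks, [tau (n - phi j)] may be replaced by [tau n] for all but
    [O(N^(3/4))] integers, those where subtracting [phi j] borrows from a high
    digit.  The frequencies of the values of [f] are prescribed by a greedy
    colouring of the blocks; with blocks of length about [sqrt t], the
    discrepancy up to [t] is [O(sqrt t)], and summing it over the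
    [O(sqrt N)] values of [sig] costs again [O(N^(3/4))].  Adding or removing a
    single element [p] affects [O(sqrt N)] values of [r2], which provides
    infinitely many sets. *)

(** * Counting below a bound *)

Definition cnt (P : pred nat) (n : nat) : nat := count P (iota 0 n).

Lemma cntS (P : pred nat) n : cnt P n.+1 = cnt P n + P n.
Proof. by rewrite /cnt -addn1 iotaD count_cat /= add0n addn0. Qed.

Lemma leq_cnt (P : pred nat) n n' : n <= n' -> cnt P n <= cnt P n'.
Proof. by move=> /subnKC <-; rewrite /cnt iotaD count_cat leq_addr. Qed.

Lemma cnt_le (P Q : pred nat) n : (forall x, x < n -> P x -> Q x) -> cnt P n <= cnt Q n.
Proof.
elim: n => // n IH PQ; rewrite !cntS leq_add ?IH //.
  by move=> x xn; apply: PQ; apply: ltnW.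
by case: (P n) (PQ n (ltnSn n)) => // ->.
Qed.

Lemma cntU (P Q : pred nat) n : cnt (predU P Q) n <= cnt P n + cnt Q n.
Proof. by rewrite /cnt -count_predUI leq_addr. Qed.

Lemma cnt_le_size (P : pred nat) n (s : seq nat) :
  (forall x, x < n -> P x -> x \in s) -> cnt P n <= size s.
Proof.
move=> sub; rewrite /cnt -size_filter; apply: uniq_leq_size.
  by rewrite filter_uniq ?iota_uniq.
by move=> x; rewrite mem_filter mem_iota => /andP[Px xn]; apply: sub.
Qed.

Lemma card_ord_cnt (P : pred nat) n : #|[set i : 'I_n | P i]| = cnt P n.
Proof.
rewrite -sum1_card /cnt -sum1_count -[X in iota 0 X]subn0 -/(index_iota 0 n) big_mkord.
by apply: eq_bigl => i; rewrite inE.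
Qed.

Lemma cnt_fibers (g : nat -> nat) (P : pred nat) S n :
  (forall x, x < n -> g x < S) ->
  cnt P n = \sum_(s < S) cnt (fun x => (g x == s) && P x) n.
Proof.
elim: n => [|n IH] gS; first by rewrite big1.
rewrite cntS IH => [|x xn]; last by apply: gS; apply: ltnW.
under [RHS]eq_bigr do rewrite cntS.
rewrite big_split /=; congr (_ + _).
rewrite (bigD1 (Ordinal (gS n (ltnSn n)))) //= eqxx /= big1 ?addn0 // => s ne.
by case: eqP => // e; case/eqP: ne; apply: val_inj.
Qed.

(** * Digit maps between bases 4 and 16 *)

Fixpoint remap_rec (b B : nat) (g : nat -> nat) (k n : nat) : nat :=
  if k is k'.+1 then g (n %% b) + B * remap_rec b B g k' (n %/ b) else 0.

(* [n] is enough fuel since [n] has at most [n] digits. *)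
Definition remap b B g n := remap_rec b B g n n.

Lemma remapE b B g n : 1 < b -> g 0 = 0 ->
  remap b B g n = g (n %% b) + B * remap b B g (n %/ b).
Proof.
move=> b1 g0.
have r0 k : remap_rec b B g k 0 = 0.
  by elim: k => //= k IH; rewrite mod0n div0n g0 IH muln0.
have fuel k l x : x <= k -> x <= l -> remap_rec b B g k x = remap_rec b B g l x.
  elim: k l x => [|k IH] [|l] x; rewrite ?leqn0 //.
  - by move=> /eqP -> _; rewrite r0.
  - by move=> _ /eqP ->; rewrite r0.
  move=> xk xl /=; congr (_ + _ * _); case: (posnP x) => [->|x0].
    by rewrite div0n !r0.
  by have := ltn_Pdiv b1 x0 => ?; apply: IH; lia.
case: (posnP n) => [->|n0]; first by rewrite mod0n div0n g0 /remap /= muln0.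
have lt := ltn_Pdiv b1 n0; rewrite /remap.
rewrite -[X in remap_rec _ _ _ X n](prednK n0) /=; congr (_ + _ * _).
by apply: fuel; lia.
Qed.

Definition phi := remap 4 16 id.
(* The base-4 digits of even and odd rank are read off the base-16 digits. *)
Definition sig := remap 16 4 (modn^~ 4).
Definition tau := remap 16 4 (divn^~ 4).

Lemma phiE t : phi t = t %% 4 + 16 * phi (t %/ 4).
Proof. exact: remapE. Qed.
Lemma sigE n : sig n = (n %% 16) %% 4 + 4 * sig (n %/ 16).
Proof. exact: remapE. Qed.
Lemma tauE n : tau n = (n %% 16) %/ 4 + 4 * tau (n %/ 16).
Proof. exact: remapE. Qed.

(** Each base-16 digit [d] is [d %% 4 + 4 * (d %/ 4)]; [sig] collects the first parts and [tau] the
    second ones. *)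
Lemma phi_sig_tau n : n = phi (sig n) + 4 * phi (tau n).
Proof.
elim/ltn_ind: n => n IH; case: (posnP n) => [->//|n0].
have := IH (n %/ 16) (ltn_Pdiv (isT : 1 < 16) n0).
rewrite [phi (sig n)]phiE [phi (tau n)]phiE.
have -> : sig n %/ 4 = sig (n %/ 16) by rewrite sigE; lia.
have -> : tau n %/ 4 = tau (n %/ 16) by rewrite tauE; lia.
have -> : sig n %% 4 = (n %% 16) %% 4 by rewrite sigE; lia.
have -> : tau n %% 4 = (n %% 16) %/ 4 by rewrite tauE; lia.
lia.
Qed.

(** Digits [a, b < 4] combine to [a + 4 * b < 16], so the addition never carries and each pair of
    digits can be recovered. *)
Lemma sig_tau_phi s t :
  (sig (phi s + 4 * phi t) = s) * (tau (phi s + 4 * phi t) = t).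
Proof.
move: {2}(s + t).+1 (ltnSn (s + t)) => k; elim: k s t => // k IH s t le.
case: (posnP (s + t)) => [|st0].
  by move/eqP; rewrite addn_eq0 => /andP[/eqP -> /eqP ->].
have [IHs IHt] := IH (s %/ 4) (t %/ 4) ltac:(lia).
rewrite sigE tauE [phi s]phiE [phi t]phiE.
set u := phi _ in IHs IHt *; set v := phi _ in IHs IHt *.
have -> : (s %% 4 + 16 * u + 4 * (t %% 4 + 16 * v)) %/ 16 = u + 4 * v by lia.
by rewrite IHs IHt; split; lia.
Qed.

Lemma phi_homo : {homo phi : s t / s < t}.
Proof.
move=> s t; elim/ltn_ind: t s => t IH s st; have t0 : 0 < t by lia.
rewrite (phiE s) (phiE t).
have [lt|eq] : s %/ 4 < t %/ 4 \/ s %/ 4 = t %/ 4 /\ s %% 4 < t %% 4 by lia.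
  by have := IH _ (ltn_Pdiv (isT : 1 < 4) t0) _ lt; lia.
by case: eq => -> ?; lia.
Qed.

Lemma leq_phi : {mono phi : s t / s <= t}.
Proof. exact: leq_mono phi_homo. Qed.

Lemma ltn_phi : {mono phi : s t / s < t}.
Proof. exact: leqW_mono leq_phi. Qed.

Lemma phiX k : phi (4 ^ k) = 16 ^ k.
Proof.
by elim: k => // k IH; rewrite phiE !expnS mulKn // IH modnMr.
Qed.

Lemma phi_ltX k s : (phi s < 16 ^ k) = (s < 4 ^ k).
Proof. by rewrite -phiX ltn_phi. Qed.

Lemma sig_ltX k n : n < 16 ^ k -> sig n < 4 ^ k.
Proof.
by rewrite -phi_ltX; apply: leq_ltn_trans; rewrite {2}[n]phi_sig_tau leq_addr.
Qed.

Lemma tau_ltX k n : n < 16 ^ k -> tau n < 4 ^ k.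
Proof.
rewrite -phi_ltX; apply: leq_ltn_trans; rewrite {2}[n]phi_sig_tau; lia.
Qed.

Lemma tau_divX e n : tau n %/ 4 ^ e = tau (n %/ 16 ^ e).
Proof.
elim: e n => [|e IH] n; first by rewrite !divn1.
rewrite !expnS !divnMA -IH; congr (_ %/ _).
by rewrite [tau n]tauE; lia.
Qed.

(** [tau n] is the rank of [n] in its fibre of [sig]: the fibre is ordered by [tau], and every value
    of [tau] occurs in it. *)
Lemma cnt_sig n : cnt (fun x => sig x == sig n) n = tau n.
Proof.
rewrite /cnt -size_filter -[RHS](size_iota 0).
rewrite -[RHS](size_map (fun t => phi (sig n) + 4 * phi t)).
apply/perm_size/uniq_perm.
- by rewrite filter_uniq ?iota_uniq.
- rewrite map_inj_uniq ?iota_uniq // => t t'.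
  by move/(congr1 tau); rewrite !sig_tau_phi.
move=> x; rewrite mem_filter mem_iota /= add0n; apply/andP/mapP.
  move=> [/eqP e lt]; exists (tau x); last by rewrite -e -phi_sig_tau.
  rewrite mem_iota /= add0n -ltn_phi.
  by move: lt; rewrite {1}[x]phi_sig_tau {1}[n]phi_sig_tau e; lia.
move=> [t]; rewrite mem_iota /= add0n -ltn_phi => lt ->; rewrite sig_tau_phi eqxx.
by split => //; rewrite {2}[n]phi_sig_tau; lia.
Qed.

(** Along a fibre of [sig], [tau] runs through 0, 1, 2, ... in order, so counting there is counting
    in an initial segment. *)
Lemma cnt_sig_tau (P : pred nat) s n :
  cnt (fun x => (sig x == s) && P (tau x)) n = cnt P (cnt (fun x => sig x == s) n).
Proof.
elim: n => // n IH; rewrite cntS [in RHS]cntS IH.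
case: eqP => [e|_]; last by rewrite !addn0.
by rewrite addn1 cntS -e cnt_sig.
Qed.

Lemma cnt_sig_le s k n : n <= 16 ^ k -> cnt (fun x => sig x == s) n <= 4 ^ k.
Proof.
elim: n => // n IH lt; rewrite cntS; case: eqP => [e|_].
  by rewrite addn1 -e cnt_sig tau_ltX.
by rewrite addn0 IH // ltnW.
Qed.

(** * Sparse sets and sums of values of [phi] *)

(* [8 = 16 `^ (3 / 4)]. *)
Definition thin (E : pred nat) := exists C, forall k, cnt E (16 ^ k) <= C * 8 ^ k.

Lemma thinU (E E' : pred nat) : thin E -> thin E' -> thin (predU E E').
Proof.
move=> [C hC] [C' hC']; exists (C + C') => k.
by rewrite mulnDl (leq_trans (cntU _ _ _)) // leq_add.
Qed.

Lemma thin_cover (E : pred nat) (s : nat -> seq nat) C :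
  (forall k n, n < 16 ^ k -> E n -> n \in s k) ->
  (forall k, size (s k) <= C * 8 ^ k) -> thin E.
Proof.
move=> cov sz; exists C => k; apply: leq_trans (sz k).
by apply: cnt_le_size; apply: cov.
Qed.

(* The sums of two values of [phi] have base-16 digits at most 6. *)
Fixpoint phi_sums k : seq nat :=
  if k is k'.+1 then [seq e + 16 * w | e <- iota 0 8, w <- phi_sums k'] else [:: 0].

(** Allowing eight digits, one more than occur, makes the size exactly the threshold used in
    [thin]. *)
Lemma size_phi_sums k : size (phi_sums k) = 8 ^ k.
Proof.
elim: k => // k IH.
change (size [seq e + 16 * w | e <- iota 0 8, w <- phi_sums k] = 8 ^ k.+1).
by rewrite size_allpairs size_iota IH expnS.
Qed.

Lemma mem_phi_sums k s s' : s < 4 ^ k -> s' < 4 ^ k -> phi s + phi s' \in phi_sums k.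
Proof.
elim: k s s' => [|k IH] s s'; first by rewrite expn0 !ltnS !leqn0 => /eqP -> /eqP ->.
rewrite expnS => sk sk'.
change (phi s + phi s' \in [seq e + 16 * w | e <- iota 0 8, w <- phi_sums k]).
apply/allpairsP.
exists (s %% 4 + s' %% 4, phi (s %/ 4) + phi (s' %/ 4)); split.
- by rewrite mem_iota /=; lia.
- by apply: IH; lia.
rewrite /=.
by rewrite [phi s]phiE [phi s']phiE; lia.
Qed.

(** * The modified basis and its exceptional integers *)

(* [f 0 = 0] makes the two parts of [bases f] disjoint. *)
Definition slow_bounded (m : nat) (f : nat -> nat) : Prop :=
  [/\ f 0 = 0, forall t, f t <= m &
      forall e t t', 16 ^ e <= t -> t %/ 4 ^ e = t' %/ 4 ^ e -> f t = f t'].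

(** By [phi_sig_tau], the clauses describe the numbers [phi s] and the numbers [phi j + 4 * phi t]
    with [j < f t]. *)
Definition bases (f : nat -> nat) : set nat :=
  fun n => tau n = 0 \/ sig n < f (tau n).

Definition sum_low : pred nat :=
  fun n => `[< exists s s', n = phi s + phi s' >].

Definition sum_high (m : nat) : pred nat :=
  fun n => `[< exists t t' j j', [/\ j < m, j' < m &
                n = 4 * (phi t + phi t') + (phi j + phi j')] >].

(** The test [n < phi j] rules out truncated subtraction. *)
Definition carries (m : nat) (f : nat -> nat) : pred nat :=
  fun n => has (fun j => (n < phi j) || (f (tau (n - phi j)) != f (tau n)))
               (iota 0 m).

(** Changing the membership of [p] can only affect sums that use [p]. *)
Definition shifted (p : nat) (A : set nat) : pred nat :=
  fun n => (n == 2 * p) || `[< exists2 a, A a & n = p + a >].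

Lemma phi_leqX k n s : n < 16 ^ k -> phi s <= n -> s < 4 ^ k.
Proof. by move=> nk sn; rewrite -phi_ltX; apply: leq_ltn_trans nk. Qed.

Lemma thin_sum_low : thin sum_low.
Proof.
apply: (thin_cover _ phi_sums 1) => [k n nk /asboolP[s [s' e]]|k].
  by rewrite e mem_phi_sums //; apply: phi_leqX nk _; rewrite e; lia.
by rewrite size_phi_sums mul1n.
Qed.

Lemma thin_sum_high m : thin (sum_high m).
Proof.
pose J := [seq phi j + phi j' | j <- iota 0 m, j' <- iota 0 m].
apply: (thin_cover _ (fun k => [seq 4 * w + e | e <- J, w <- phi_sums k]) (m * m)).
  move=> k n nk /asboolP[t [t' [j [j' [jm jm' e]]]]].
  apply/allpairsP; exists (phi j + phi j', phi t + phi t'); split=> //=.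
    by apply/allpairsP; exists (j, j'); rewrite !mem_iota.
  by apply: mem_phi_sums; apply: phi_leqX nk _; rewrite e; lia.
by move=> k; rewrite !size_allpairs !size_iota size_phi_sums.
Qed.

(** Let [n < 16 ^ k]. If [n %% B k >= phi m], subtracting [phi j] with [j < m] changes only the
    lowest [k %/ 4] digits; if also [tau n >= B k], [f] does not see this change. The two lists in
    [S k] contain all other [n]. *)
Lemma thin_carries m f : slow_bounded m f -> thin (carries m f).
Proof.
move=> [f0 fm slow].
pose B k := 16 ^ (k %/ 4).
pose S k := [seq phi s + 4 * phi t | s <- iota 0 (4 ^ k), t <- iota 0 (B k)] ++
  [seq B k * q + r | q <- iota 0 (16 ^ (k - k %/ 4)), r <- iota 0 (phi m)].
apply: (thin_cover _ S (1 + 8 * phi m)).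
  move=> k n nk; apply: contraLR; rewrite mem_cat negb_or => /andP[n1 n2].
  have B0 : 0 < B k by rewrite expn_gt0.
  have lt_mod j : j < m -> phi j <= n %% B k.
    rewrite -ltn_phi => jm; rewrite leqNgt; apply: contra n2 => lt.
    apply/allpairsP; exists (n %/ B k, n %% B k); split=> /=; last first.
    - by rewrite mulnC -divn_eq.
    - by rewrite mem_iota /=; lia.
    by rewrite mem_iota ltn_divLR // -expnD subnK // leq_div.
  have tn : B k <= tau n.
    rewrite leqNgt; apply: contra n1 => lt.
    apply/allpairsP; exists (sig n, tau n); split=> /=; last exact: phi_sig_tau.
      by rewrite mem_iota sig_ltX.
    by rewrite mem_iota.
  rewrite -all_predC; apply/allP => j; rewrite mem_iota /= => /lt_mod jn.
  rewrite negb_or negbK -leqNgt (leq_trans jn (leq_mod _ _)) /= eq_sym.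
  apply/eqP/(slow (k %/ 4)) => //; rewrite !tau_divX; congr tau.
  rewrite -/(B k) [X in _ = (X - _) %/ _](divn_eq n (B k)) -addnBA // divnMDl //.
  rewrite [X in _ + X]divn_small ?addn0 //.
  by rewrite (leq_ltn_trans (leq_subr _ _)) // ltn_mod.
(* The choice of [B] balances the lists: [4 ^ k * B k <= 8 ^ k] and
   [16 ^ (k - k %/ 4) <= 8 * 8 ^ k], where the factor 8 absorbs the rounding in [k %/ 4]. *)
move=> k; rewrite size_cat !size_allpairs !size_iota mulnDl mul1n.
have p2 a b : (2 ^ a) ^ b = 2 ^ (a * b) by rewrite expnM.
have e4 : 4 ^ k = 2 ^ (2 * k) by rewrite -(p2 2).
have e8 : 8 ^ k = 2 ^ (3 * k) by rewrite -(p2 3).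
have e16 l : 16 ^ l = 2 ^ (4 * l) by rewrite -(p2 4).
rewrite /B e4 e8 !e16 leq_add //; first by rewrite -expnD leq_exp2l //; lia.
rewrite [X in _ <= X]mulnAC leq_mul2r; apply/orP; right.
by rewrite -[8]/(2 ^ 3) -expnD leq_exp2l //; lia.
Qed.

Lemma r2_bases m f n : slow_bounded m f -> ~~ sum_low n -> ~~ sum_high m n ->
  ~~ carries m f n -> r2 (bases f) n = f (tau n).
Proof.
move=> [f0 fm _] /asboolPn low /asboolPn high /hasPn carry.
set F := f (tau n).
have Fm j : j < F -> j < m by move=> jF; apply: leq_trans jF (fm _).
have good j : j < m -> phi j <= n /\ f (tau (n - phi j)) = F.
  move=> jm; have /carry : j \in iota 0 m by rewrite mem_iota.
  by rewrite negb_or negbK -leqNgt => /andP[? /eqP].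
(* [x j + z j] is the only candidate for a mixed representation of [n] whose high summand has [sig]
   equal to [j]. For [j < m], [z j] satisfies the second clause of [bases f] exactly when
   [j < F]. *)
pose x j := phi (sig (n - phi j)).
pose z j := phi j + 4 * phi (tau (n - phi j)).
have xz j : j < m -> x j + z j = n.
  by move=> /good[jn _]; rewrite /x /z addnCA -phi_sig_tau subnKC.
have phi0 s : phi s = phi s + 4 * phi 0 by rewrite addn0.
have taux j : tau (x j) = 0 by rewrite /x phi0 sig_tau_phi.
have tauz j : tau (z j) = tau (n - phi j) by rewrite sig_tau_phi.
have sigz j : sig (z j) = j by rewrite sig_tau_phi.
(* Since [f 0 = 0], [z j] never has the form [x j'], so the sorting done by [g] below does not
   destroy injectivity. *)
have tauz0 j : j < F -> tau (z j) != 0.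
  move=> jF; rewrite tauz; apply/eqP => t0.
  by have [_] := good _ (Fm _ jF); rewrite t0 f0 => e; rewrite -e in jF.
have XZ u v : tau u = 0 -> sig v < f (tau v) -> u + v = n ->
    [/\ sig v < F, x (sig v) = u & z (sig v) = v].
  move=> u0 vZ uv.
  have eu : u = phi (sig u) by rewrite {1}[u]phi_sig_tau u0 addn0.
  have e : n - phi (sig v) = phi (sig u) + 4 * phi (tau v).
    by rewrite -uv -eu {1}[v]phi_sig_tau; lia.
  rewrite /x /z e !sig_tau_phi -eu -phi_sig_tau; split=> //.
  have [_ <-] := good _ (leq_trans vZ (fm _)).
  by rewrite e sig_tau_phi.
pose g j := if x j <= z j then (x j, z j) else (z j, x j).
have g_le j : j < m -> (g j).1 <= n /\ (g j).2 <= n.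
  by move=> /xz <-; rewrite /g; case: ifP => _ /=; rewrite leq_addr leq_addl.
pose h (j : 'I_F) : 'I_n.+1 * 'I_n.+1 := (inord (g j).1, inord (g j).2).
have h_val j : (val (h j).1, val (h j).2) = g j.
  have [l1 l2] := g_le _ (Fm _ (ltn_ord j)).
  by rewrite /= !inordK ?ltnS //; case: (g j).
rewrite /r2; transitivity #|[set h j | j in 'I_F]|; last first.
  rewrite card_imset ?card_ord // => j j' e; apply: val_inj => /=.
  have : g j = g j' by rewrite -!h_val e.
  rewrite /g; case: ifP => _; case: ifP => _ [] e1 e2.
  - by rewrite -[LHS]sigz e2 sigz.
  - by have := tauz0 j' (ltn_ord _); rewrite -e1 taux.
  - by have := tauz0 j (ltn_ord _); rewrite e1 taux.
  - by rewrite -[LHS]sigz e1 sigz.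
congr #|pred_of_set _|; apply/setP => -[a b]; rewrite inE /=.
apply/and4P/imsetP => [[/asboolP Aa /asboolP Ab ab /eqP abn]|[j _ e]].
  have hE j : j < F -> g j = (val a, val b) ->
      exists2 j, j \in 'I_F & (a, b) = h j.
    move=> jF ej; exists (Ordinal jF) => //.
    by rewrite /h /= ej /= !inord_val.
  (* Two low summands contradict [low], two high ones contradict [high]; the mixed cases come from
     [XZ]. *)
  case: Aa => Aa; case: Ab => Ab.
  - case: low; exists (sig a), (sig b); rewrite -[LHS]abn.
    by rewrite {1}[val a]phi_sig_tau {1}[val b]phi_sig_tau Aa Ab !addn0.
  - have [jF ex ez] := XZ _ _ Aa Ab abn.
    by apply: (hE _ jF); rewrite /g ex ez ab.
  - have [jF ex ez] := XZ _ _ Ab Aa (etrans (addnC _ _) abn).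
    apply: (hE _ jF); rewrite /g ex ez; case: ifP => // ba.
    by have e : a = b :> nat by [apply/eqP; rewrite eqn_leq ab]; rewrite /= e.
  - case: high; exists (tau a), (tau b), (sig a), (sig b).
    split; [exact: leq_trans Aa (fm _)|exact: leq_trans Ab (fm _)|].
    by move: abn (phi_sig_tau a) (phi_sig_tau b) => /=; lia.
have jm := Fm _ (ltn_ord j).
have [ea eb] : (g j).1 = a /\ (g j).2 = b by rewrite -h_val -e.
have Ax : bases f (x j) by left.
have Az : bases f (z j).
  by right; rewrite sigz tauz; have [_ ->] := good _ jm.
rewrite -ea -eb /g; case: leqP => /= [|/ltnW] le.
  by rewrite xz //; split=> //; apply/asboolP.
by rewrite addnC xz //; split=> //; apply/asboolP.
Qed.

(** * Toggling one element *)

(** Symmetric difference with [{p}]; unlike adding [p], it yields distinct sets for distinct [p],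
    whatever [A] is. *)
Definition toggle (p : nat) (A : set nat) : set nat :=
  fun n => (n = p /\ ~ A n) \/ (n <> p /\ A n).

Lemma r2_toggle p A n : ~~ shifted p A n -> r2 (toggle p A) n = r2 A n.
Proof.
rewrite negb_or => /andP[/eqP n2p /asboolPn nA].
have tA a : a <> p -> `[< toggle p A a >] = `[< A a >].
  move=> ap; apply/asboolP/asboolP => [[[]//|[]//]|Aa]; by right.
(* The partner of [p] in a sum equal to [n] lies in neither set, so pairs using [p] count on neither
   side. *)
have out a b : a = p -> a + b = n -> `[< A b >] = false /\ `[< toggle p A b >] = false.
  move=> -> e.
  have bp : b <> p by move=> bp; apply: n2p; rewrite -e bp; lia.
  rewrite tA //; suff /asboolPn/negbTE -> : ~ A b by [].
  by move=> Ab; apply: nA; exists b.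
congr #|pred_of_set _|; apply/setP => -[a b]; rewrite !inE /=.
have [e|] := eqVneq (a + b) n; last by rewrite !andbF.
case: (pselect (a = p :> nat)) => [/out/(_ e)[-> ->]|ap]; first by rewrite !andbF.
rewrite tA //; case: (pselect (b = p :> nat)) => [|bp]; last by rewrite tA.
by move=> /out/(_ (etrans (addnC _ _) e))[E1 E2]; rewrite E1 !andFb.
Qed.

Lemma thin_shifted p m f : slow_bounded m f -> thin (shifted p (bases f)).
Proof.
move=> [_ fm _].
pose S k := (2 * p) :: [seq p + phi s | s <- iota 0 (4 ^ k)] ++
  [seq p + (phi j + 4 * phi t) | j <- iota 0 m, t <- iota 0 (4 ^ k)].
apply: (thin_cover _ S (2 + m)).
  move=> k n nk /orP[/eqP ->|/asboolP[a Aa e]]; first by rewrite mem_head.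
  have ak : a < 16 ^ k by apply: leq_ltn_trans nk; rewrite e leq_addl.
  rewrite inE mem_cat; apply/orP; right; apply/orP; case: Aa => Aa; [left|right].
    apply/mapP; exists (sig a); first by rewrite mem_iota sig_ltX.
    by rewrite e {1}[a]phi_sig_tau Aa addn0.
  apply/allpairsP; exists (sig a, tau a); rewrite !mem_iota tau_ltX //=.
  by rewrite -phi_sig_tau; split=> //; apply: leq_trans Aa (fm _).
move=> k; rewrite /= size_cat size_map size_allpairs !size_iota.
have le48 : 4 ^ k <= 8 ^ k by case: k => // k; rewrite leq_exp2r.
have pos8 : 0 < 8 ^ k by rewrite expn_gt0.
have : m * 4 ^ k <= m * 8 ^ k by rewrite leq_mul2l le48 orbT.
by rewrite mulnDl; lia.
Qed.

(** * Colourings constant on long blocks *)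

(** For [16 ^ l <= t < 16 ^ l.+1] the blocks have length [4 ^ l], of order [sqrt t], and use the
    colours [c s] with [4 ^ l <= s < 16 * 4 ^ l]. *)
Definition blocked (c : nat -> nat) (t : nat) : nat :=
  if t == 0 then 0 else c (t %/ 4 ^ trunc_log 16 t).

Lemma slow_bounded_blocked m c : (forall s, c s <= m) -> slow_bounded m (blocked c).
Proof.
move=> cm; split=> // [t|e t t' et tt']; first by rewrite /blocked; case: eqP.
have lelog x : 16 ^ e <= x -> 0 < x /\ e <= trunc_log 16 x.
  move=> ex; have x0 : 0 < x by apply: leq_trans ex; rewrite expn_gt0.
  by split=> //; rewrite -(trunc_expnK e (isT : 1 < 16)) leq_trunc_log.
(* [16 ^ l] is a multiple of [4 ^ e], so no aligned block of length [4 ^ e] straddles it; hence [t]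
   and [t'] lie on the same level. *)
have log_ge l x x' : e <= l -> x %/ 4 ^ e = x' %/ 4 ^ e ->
    (16 ^ l <= x) = (16 ^ l <= x').
  move=> el xx'; have -> : 16 ^ l = 16 ^ l %/ 4 ^ e * 4 ^ e.
    rewrite divnK // (_ : 16 = 4 * 4) // expnMn dvdn_mulr // dvdn_exp2l //.
  by rewrite -!leq_divRL ?expn_gt0 // xx'.
have et' : 16 ^ e <= t' by rewrite -(log_ge e t).
have [t0 lt] := lelog t et; have [t'0 lt'] := lelog t' et'.
have blockedE x : 0 < x -> blocked c x = c (x %/ 4 ^ trunc_log 16 x).
  by rewrite /blocked; case: eqP => // ->.
rewrite !blockedE //.
have -> : trunc_log 16 t' = trunc_log 16 t.
  apply/eqP; rewrite eqn_leq; apply/andP; split.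
    apply: trunc_log_max => //; rewrite (log_ge _ t t') //.
    exact: trunc_logP.
  apply: trunc_log_max => //; rewrite -(log_ge _ t t') //.
  exact: trunc_logP.
congr c; rewrite -(subnKC lt) expnD !divnMA tt' //.
Qed.

Lemma cnt_divn (P : pred nat) q n : 0 < q ->
  cnt (fun t => P (t %/ q)) n = q * cnt P (n %/ q) + (n %% q) * P (n %/ q).
Proof.
move=> q0; elim: n => [|n IH]; first by rewrite div0n mod0n /cnt /= muln0.
rewrite cntS IH divnS // modnS; case: ifP => dv /=; last by rewrite add0n mulSn; lia.
rewrite mul0n addn0 add1n cntS mulnDr -addnA -mulSnr; congr (_ + _ * _).
have /dvdnP[d e] := dv.
have : (n %% q).+1 %% q = 0 by rewrite -addn1 modnDml addn1; apply/eqP.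
have : (n %% q).+1 <= q by rewrite ltn_mod.
rewrite leq_eqVlt => /orP[/eqP //|lt]; by rewrite modn_small.
Qed.

(** * Discrepancy estimates *)

Local Open Scope classical_set_scope.
Local Open Scope ring_scope.

(** Taking fourth powers reduces this to [8 ^ (4 * k) = 16 ^ (3 * k) <= N ^ 3]. *)
Lemma powR_34 (R : realType) (k N : nat) :
  (16 ^ k <= N)%N -> (8 ^ k)%:R <= (N%:R : R) `^ (3 / 4).
Proof.
move=> kN; rewrite -(@ler_pXn2r _ 4) ?nnegrE ?powR_ge0 //.
have -> : (N%:R : R) `^ (3 / 4) ^+ 4 = N%:R ^+ 3.
  rewrite -powR_mulrn ?powR_ge0 // -powRrM -powR_mulrn //.
  by congr (_ `^ _); field.
rewrite -!natrX ler_nat; apply: (@leq_trans ((16 ^ k) ^ 3)); last by rewrite leq_exp2r.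
by rewrite -!expnM mulnC expnM [X in (_ <= X)%N](_ : _ = (16 ^ 3) ^ k)%N // -expnM mulnC.
Qed.

Lemma balanced_coloring (R : realType) (m : nat) (alpha : 'I_m.+1 -> R) :
    (forall i, 0 <= alpha i) -> \sum_(i < m.+1) alpha i = 1 ->
  exists c : nat -> 'I_m.+1, forall i n,
    `|(cnt (fun s => c s == i) n)%:R - alpha i * n%:R| <= m.+1%:R.
Proof.
move=> a0 a1.
(* Greedily choose a colour that is behind its quota: each deviation then stays
   at most 1, and the deviations sum to 0. *)
pose choice (n : nat) (v : 'I_m.+1 -> nat) : 'I_m.+1 :=
  odflt ord0 [pick i | (v i)%:R < alpha i * n.+1%:R].
pose st n := iteri n (fun k v i => (v i + (choice k v == i))%N) (fun=> 0%N).
have stS n i : st n.+1 i = (st n i + (choice n (st n) == i))%N by [].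
have st_cnt n i : st n i = cnt (fun s => choice s (st s) == i) n.
  by elim: n => // n IH; rewrite stS IH cntS.
have sum_st n : (\sum_(i < m.+1) st n i)%N = n.
  elim: n => [|n IH]; first by rewrite big1.
  under eq_bigr do rewrite stS.
  rewrite big_split IH /= (bigD1 (choice n (st n))) //= eqxx big1 ?addn0 ?addn1 //.
  by move=> i; rewrite eq_sym => /negbTE ->.
have sum_quota n : \sum_(i < m.+1) alpha i * n%:R = n%:R by rewrite -mulr_suml a1 mul1r.
(* Some colour is behind, as the quotas at [n.+1] sum to [n.+1] while the counts sum to [n]. *)
have behind n : (st n (choice n (st n)))%:R < alpha (choice n (st n)) * n.+1%:R.
  rewrite /choice; case: pickP => //= none.
  have : \sum_(i < m.+1) alpha i * n.+1%:R <= \sum_(i < m.+1) (st n i)%:R.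
    by apply: ler_sum => i _; rewrite leNgt none.
  by rewrite sum_quota -natr_sum sum_st ler_nat ltnn.
have upper n i : (st n i)%:R <= alpha i * n%:R + 1.
  elim: n => [|n IH]; first by rewrite mulr0 add0r ler01.
  rewrite stS; case: eqP => [<-|_]; first by rewrite natrD lerD2r ltW ?behind.
  rewrite addn0 (le_trans IH) // lerD2r ler_wpM2l // ler_nat //.
exists (fun s => choice s (st s)) => i n; rewrite -st_cnt ler_norml; apply/andP; split.
  (* Lower bound: the deviation of [i] is minus the sum of the others, each at most 1. *)
  have : \sum_(j < m.+1 | j != i) (st n j)%:R <=
         \sum_(j < m.+1 | j != i) (alpha j * n%:R + 1) by apply: ler_sum.
  rewrite big_split /= sumr_const.
  have := sum_st n; rewrite (bigD1 i) //= => /(congr1 (fun x => x%:R : R)).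
  rewrite natrD natr_sum.
  have := sum_quota n; rewrite (bigD1 i) //=.
  have : #|[pred j : 'I_m.+1 | j != i]|%:R <= m.+1%:R :> R.
    by rewrite ler_nat (leq_trans (max_card _)) // card_ord.
  rewrite (_ : #|_| = #|[pred j : 'I_m.+1 | j != i]|) //.
  lra.
have := upper n i; have : 1 <= m.+1%:R :> R by rewrite ler1n.
lra.
Qed.

(** On each level [blocked c] agrees with a colouring [G] in blocks of fixed length, whose
    discrepancy is proportional to that length. The lengths grow geometrically, so the last level
    dominates. *)
Lemma blocked_discrepancy (R : realType) (c : nat -> nat) (u : nat) (a : R)
    (B k T : nat) :
    0 <= a <= 1 -> (0 < B)%N ->
    (forall n, `|(cnt (fun s => c s == u) n)%:R - a * n%:R| <= B%:R) ->
    (T <= 4 ^ k)%N ->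
  `|(cnt (fun t => blocked c t == u) T)%:R - a * T%:R| <= (16 * B * 2 ^ k)%:R.
Proof.
move=> /andP[a0 a1] B0 disc.
pose P t := blocked c t == u.
pose G q t := c (t %/ q)%N == u.
have discG q n : (0 < q)%N -> `|(cnt (G q) n)%:R - a * n%:R| <= (2 * B * q)%:R.
  move=> q0; rewrite /G (cnt_divn (fun s => c s == u)) //.
  rewrite [X in a * X%:R](divn_eq n q).
  set d := (n %/ q)%N; set r := (n %% q)%N; set b : nat := c d == u.
  have -> : (q * cnt (fun s => c s == u) d + r * b)%:R - a * (d * q + r)%:R =
    q%:R * ((cnt (fun s => c s == u) d)%:R - a * d%:R) + r%:R * (b%:R - a) :> R.
    by rewrite !natrD !natrM; ring.
  have rq : r%:R <= q%:R :> R by rewrite ler_nat ltnW // ltn_mod.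
  have h1 : `|b%:R - a| <= 1 :> R.
    by rewrite /b ler_norml; case: eqP => _ /=; apply/andP; split; lra.
  apply: (le_trans (ler_normD _ _)); rewrite !normrM !normr_nat.
  have le1 : q%:R * `|(cnt (fun s => c s == u) d)%:R - a * d%:R| <= q%:R * B%:R :> R.
    by rewrite ler_wpM2l.
  have le2 : r%:R * `|b%:R - a| <= q%:R * B%:R :> R.
    apply: ler_pM => //; apply: (le_trans h1); by rewrite ler1n.
  by rewrite !natrM; lra.
have trivial n : `|(cnt P n)%:R - a * n%:R| <= n%:R.
  have : (cnt P n)%:R <= n%:R :> R.
    by rewrite ler_nat (leq_trans (count_size _ _)) // size_iota.
  have : 0 <= (cnt P n)%:R :> R by [].
  have : 0 <= a * n%:R by rewrite mulr_ge0.
  have : a * n%:R <= n%:R by rewrite ler_piMl.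
  by move=> *; rewrite ler_norml; apply/andP; split; lra.
(* [P] and [G (4 ^ e)] have equal increments on this level; the additive form avoids subtraction in
   [nat]. *)
have step e n : (16 ^ e <= n <= 16 ^ e.+1)%N ->
    (cnt P n + cnt (G (4 ^ e)) (16 ^ e) = cnt (G (4 ^ e)) n + cnt P (16 ^ e))%N.
  elim: n => [|n IH]; first by rewrite leqn0 expn_eq0.
  case/andP; rewrite leq_eqVlt => /orP[/eqP <- _|en ne]; first by rewrite addnC.
  have := IH ltac:(by rewrite -ltnS en ltnW); rewrite !cntS.
  suff -> : P n = G (4 ^ e)%N n by lia.
  have n0 : (0 < n)%N by apply: leq_trans (en : (16 ^ e <= n)%N); rewrite expn_gt0.
  rewrite /P /G /blocked -[n == 0%N]negbK -lt0n n0 /=.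
  by rewrite (@trunc_log_eq _ e) //; apply/andP.
(* In units of [B * 4 ^ e], the induction step adds two errors of 8 from [discG] to the previous 16,
   which stays below 64. *)
have key e n : (n <= 16 ^ e.+1)%N -> `|(cnt P n)%:R - a * n%:R| <= (16 * B * 4 ^ e)%:R.
  elim: e n => [|e IH] n ne.
    by apply: (le_trans (trivial n)); rewrite ler_nat (leq_trans ne) // muln1 leq_pmulr.
  have [le|lt] := leqP n (16 ^ e.+1).
    by apply: (le_trans (IH _ le)); rewrite ler_nat leq_mul2l leq_exp2l ?leqnSn ?orbT.
  have /(congr1 (fun x => x%:R : R)) := step e.+1 n ltac:(by rewrite (ltnW lt)).
  have := IH _ (leqnn _).
  have := discG (4 ^ e.+1)%N n ltac:(by rewrite expn_gt0).
  have := discG (4 ^ e.+1)%N (16 ^ e.+1)%N ltac:(by rewrite expn_gt0).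
  rewrite !natrD (expnS 4 e).
  have -> : (2 * B * (4 * 4 ^ e))%:R = 8 * (B * 4 ^ e)%:R :> R by rewrite !natrM; ring.
  have -> : (16 * B * 4 ^ e)%:R = 16 * (B * 4 ^ e)%:R :> R by rewrite !natrM; ring.
  have -> : (16 * B * (4 * 4 ^ e))%:R = 64 * (B * 4 ^ e)%:R :> R by rewrite !natrM; ring.
  have : 0 <= (B * 4 ^ e)%:R :> R by [].
  rewrite !ler_norml => ? /andP[? ?] /andP[? ?] /andP[? ?] ?.
  by apply/andP; split; lra.
move=> Tk; apply: (le_trans (key (k %/ 2)%N T _)).
  apply: (leq_trans Tk); rewrite (_ : 16 = 4 ^ 2)%N // -expnM leq_exp2l //; lia.
rewrite ler_nat leq_mul2l (_ : 4 = 2 ^ 2)%N // -expnM leq_exp2l //; lia.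
Qed.

(** There are at most [4 ^ k] fibres of [sig], each an initial segment in terms of [tau] and
    contributing [C * 2 ^ k]. *)
Lemma tau_discrepancy (R : realType) (f : nat -> nat) (u : nat) (a : R) (C k N : nat) :
    (forall T, (T <= 4 ^ k)%N ->
      `|(cnt (fun t => f t == u) T)%:R - a * T%:R| <= (C * 2 ^ k)%:R) ->
    (N <= 16 ^ k)%N ->
  `|(cnt (fun n => f (tau n) == u) N)%:R - a * N%:R| <= (C * 8 ^ k)%:R.
Proof.
move=> disc Nk.
have sigN n : (n < N)%N -> (sig n < 4 ^ k)%N.
  by move=> nN; apply/sig_ltX/(leq_trans nN).
pose T s := cnt (fun x => sig x == s) N.
have -> : N%:R = \sum_(s < 4 ^ k) (T s)%:R :> R.
  rewrite -natr_sum; congr _%:R.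
  rewrite -{1}(size_iota 0 N) -(count_predT (iota 0 N)) -/(cnt predT N).
  rewrite (cnt_fibers sig predT (4 ^ k)) //; apply: eq_bigr => s _.
  by apply: eq_count => x /=; rewrite andbT.
have -> : (cnt (fun n => f (tau n) == u) N)%:R =
    \sum_(s < 4 ^ k) (cnt (fun t => f t == u) (T s))%:R :> R.
  rewrite -natr_sum (cnt_fibers sig _ (4 ^ k)) //; congr _%:R.
  by apply: eq_bigr => s _; rewrite (cnt_sig_tau (fun t => f t == u)).
rewrite mulr_sumr -sumrB (le_trans (ler_norm_sum _ _ _)) //.
have : \sum_(s < 4 ^ k) `|(cnt (fun t => f t == u) (T s))%:R - a * (T s)%:R| <=
       \sum_(s < 4 ^ k) (C * 2 ^ k)%:R :> R.
  by apply: ler_sum => s _; apply/disc/cnt_sig_le.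
move=> /le_trans; apply.
rewrite sumr_const card_ord -[_ *+ (4 ^ k)%N]mulr_natr -natrM ler_nat.
by rewrite -mulnA leq_mul2l -expnMn leqnn orbT.
Qed.

(** * Infinitely many sets with the prescribed frequencies *)

Lemma toggle_inj A : injective (toggle^~ A).
Proof.
move=> p q e; apply: contrapT => pq.
have : toggle p A p <-> toggle q A p by rewrite e.
rewrite /toggle; case: (pselect (A p)) => Ap; tauto.
Qed.

Theorem theorem1p1 (R : realType) (m : nat) (m_gt0 : (0 < m)%N)
    (alpha : 'I_m.+1 -> R)
    (alpha_ge0 : forall i, 0 <= alpha i)
    (alpha_sum : \sum_(i < m.+1) alpha i = 1) :
  infinite_set
    [set A : set nat | A !=set0 /\
      exists C : R, forall (i : 'I_m.+1) (N : nat), (0 < N)%N ->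
        `|(S2 i A N)%:R - alpha i * N%:R| <= C * (N%:R `^ (3 / 4))].
Proof.
have [c discc] := balanced_coloring R m alpha alpha_ge0 alpha_sum.
pose f := blocked (fun s => c s).
have slow : slow_bounded m f.
  by apply: slow_bounded_blocked => s; rewrite -ltnS ltn_ord.
have alpha_le1 i : 0 <= alpha i <= 1.
  by rewrite alpha_ge0 -alpha_sum (bigD1 i) //= lerDl sumr_ge0.
have disc (i : 'I_m.+1) k N : (N <= 16 ^ k)%N ->
    `|(cnt (fun n => f (tau n) == i) N)%:R - alpha i * N%:R| <= (16 * m.+1 * 8 ^ k)%:R.
  apply: tau_discrepancy => T; apply: blocked_discrepancy => // n.
  by apply: le_trans (discc i n).
apply/infiniteP/pcard_leP/injfunPex; exists (toggle^~ (bases f)); last first.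
  by move=> p q _ _; apply: toggle_inj.
move=> p _; split.
  (* Both 0 and 1 have [tau] equal to 0, and toggling [p] removes at most one of them. *)
  case: p => [|p]; [exists 1%N|exists 0%N]; by right; split=> //; left.
pose E := predU (predU sum_low (sum_high m)) (predU (carries m f) (shifted p (bases f))).
have [Ce thinE] : thin E.
  apply: thinU; apply: thinU.
  - exact: thin_sum_low.
  - exact: thin_sum_high.
  - exact: thin_carries.
  - exact: thin_shifted slow.
have r2E n : ~~ E n -> r2 (toggle p (bases f)) n = f (tau n).
  move=> /norP[/norP[? ?] /norP[? ?]].
  by rewrite r2_toggle // (r2_bases m).
(* [Ce] bounds the exceptions and [16 * m.+1] the discrepancy; 8 is the loss from [8 ^ k] to
   [8 ^ k.+1], and 2 pays for [n = 0] and for [N.+1] in place of [N]. *)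
exists (8 * (Ce + 16 * m.+1) + 2)%:R => i N N0.
have /andP[kN Nk] := trunc_log_bounds (isT : 1 < 16)%N N0.
set k := trunc_log 16 N in kN Nk.
have pw := powR_34 R k N kN; set P := _ `^ _ in pw *.
have /ler_normlP[d1 d2] := disc i k.+1 N.+1 Nk.
pose Qp n := f (tau n) == i; pose Sp n := (0 < n)%N && (r2 (toggle p (bases f)) n == i).
rewrite /S2 (card_ord_cnt Sp).
set S := cnt Sp N.+1; set Q := cnt _ N.+1 in d1 d2.
have Ebound : (cnt E N.+1 <= Ce * 8 ^ k.+1)%N by apply: leq_trans (thinE _); apply: leq_cnt.
have SQ : (S <= Q + cnt E N.+1)%N.
  apply: leq_trans (cntU Qp E _); apply: cnt_le => n _ /andP[_ /eqP rn].
  change (Qp n || E n); case: (boolP (E n)) => [|/r2E e]; first by rewrite orbT.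
  by rewrite /Qp -e rn eqxx.
(* [Q] may count [n = 0], which [S2] excludes. *)
have QS : (Q <= S + (cnt E N.+1 + 1))%N.
  have c0 : (cnt (pred1 0%N) N.+1 <= 1)%N.
    by apply: (cnt_le_size _ _ [:: 0%N]) => x _ /eqP ->; rewrite mem_head.
  apply: leq_trans (_ : S + (cnt E N.+1 + cnt (pred1 0%N) N.+1) <= _)%N; last first.
    by rewrite !leq_add2l.
  apply: leq_trans (leq_add (leqnn _) (cntU E (pred1 0%N) _)).
  apply: leq_trans (cntU Sp (predU E (pred1 0%N)) _).
  apply: cnt_le => n _ /eqP fn; change [|| Sp n, E n | n == 0%N].
  case: (posnP n) => [->|n0]; first by rewrite !orbT.
  case: (boolP (E n)) => [|/r2E e]; first by rewrite orbT.
  by rewrite /Sp n0 e fn eqxx.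
have SQr : S%:R <= Q%:R + (Ce * 8 ^ k.+1)%:R :> R.
  by rewrite -natrD ler_nat (leq_trans SQ) // leq_add2l.
have QSr : Q%:R <= S%:R + (Ce * 8 ^ k.+1)%:R + 1 :> R.
  rewrite -addrA -[1]/(1%:R) -!natrD ler_nat (leq_trans QS) //.
  by rewrite leq_add2l leq_add2r.
have /andP[a0 a1] := alpha_le1 i.
have e8 D : (D * 8 ^ k.+1)%:R = 8 * D%:R * (8 ^ k)%:R :> R.
  by rewrite expnS !natrM; ring.
have k1 : 1 <= (8 ^ k)%:R :> R by rewrite ler1n expn_gt0.
have D0 : 0 <= 8 * (Ce%:R + (16 * m.+1)%:R) :> R by rewrite mulr_ge0 // addr_ge0.
have b1 : 8 * (Ce%:R + (16 * m.+1)%:R) * (8 ^ k)%:R <=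
          8 * (Ce%:R + (16 * m.+1)%:R) * P by rewrite ler_wpM2l.
move: d1 d2 SQr QSr; rewrite !e8 natrD natrM natrD mulrDl -(natr1 N) => *.
rewrite ler_norml; apply/andP; split; lra.
Qed.
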